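(* Let $X$ be an abelian Polish group. Then the collection of all Haar meager subsets of $X$ is a $\sigma$-ideal.
   Context: An abelian Polish group is an abelian topological group (written additively) whose topology is separable and completely metrizable. For $B\subseteq X$ and $x\in X$, $B+x=\{b+x : b\in B\}$. A subset of a topological space is meager in that space if it is a countable union of nowhere dense subsets of that space. A set $A\subseteq X$ is Haar meager if there exist a Borel set $B\subseteq X$ with $A\subseteq B$, a nonempty compact metric space $K$, and a continuous function $f:K\to X$ such that $f^{-1}(B+x)$ is meager in $K$ for every $x\in X$. A $\sigma$-ideal of subsets of $X$ is a nonempty collection of subsets of $X$ that is hereditary (closed under taking subsets) and closed under countable unions. *)

(* Defs.v *)
From HB Require Import structures.
From mathcomp Require Import all_boot all_order all_algebra.
From mathcomp Require Import all_classical all_reals all_analysis.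

Set Implicit Arguments.
Unset Strict Implicit.
Unset Printing Implicit Defensive.

Import Order.TTheory GRing.Theory Num.Theory.

Local Open Scope classical_set_scope.
Local Open Scope ring_scope.

Definition separable (T : topologicalType) : Prop :=
  exists2 D : set T, countable D & dense D.

(* [metricType] spaces need not be pointed, hence the explicit limit. *)
Definition complete_metric (R : realType) (M : metricType R) : Prop :=
  forall u : nat -> M, cauchy (u @ \oo) -> exists l : M, u @ \oo --> l.

Definition homeomorphic (S T : topologicalType) : Prop :=
  exists (f : S -> T) (g : T -> S),
    [/\ cancel f g, cancel g f, continuous f & continuous g].

(* Transporting the metric of [M] along the homeomorphism yields a complete
   metric on [T] that induces the topology of [T], and conversely. *)
Definition completely_metrizable (R : realType) (T : topologicalType) : Prop :=
  exists2 M : metricType R, complete_metric M & homeomorphic M T.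

Definition polish (R : realType) (T : topologicalType) : Prop :=
  separable T /\ completely_metrizable R T.

Definition borel (T : topologicalType) : set (set T) :=
  <<s [set U : set T | open U] >>.

Definition nowhere_dense (T : topologicalType) (A : set T) : Prop :=
  interior (closure A) = set0.

Definition meager (T : topologicalType) (A : set T) : Prop :=
  exists2 F : nat -> set T,
    forall n, nowhere_dense (F n) & A = \bigcup_n F n.

Definition translate (X : zmodType) (B : set X) (x : X) : set X :=
  [set b + x | b in B].

Definition haar_meager (R : realType) (X : topologicalZmodType) (A : set X) :
    Prop :=
  exists B : set X, [/\ borel B, A `<=` B &
    exists K : metricType R, [/\ [set: K] !=set0, compact [set: K] &
      exists2 f : K -> X, continuous f &
        forall x : X, meager (f @^-1` translate B x)]].

Definition sigma_ideal (T : Type) (I : set (set T)) : Prop :=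
  [/\ I !=set0,
      forall A B : set T, A `<=` B -> I B -> I A &
      forall A : nat -> set T, (forall n, I (A n)) -> I (\bigcup_n A n)].

(* Main.v *)
Require Import Defs.
From HB Require Import structures.
From mathcomp Require Import all_boot all_order all_algebra.
From mathcomp Require Import all_classical all_reals all_analysis.
From mathcomp Require Import ring.

(** Heredity is immediate, and the empty set is witnessed by a constant map on
a one-point space; the content is closure under countable unions
([haar_meager_bigcup]).

Let [B n] be Borel hulls of the given sets, each with a witness
[f_n : K_n -> X].  The union of the [B n] is witnessed by the infinite sum
[f x = \sum_n f_n (x n)] on the product [K] of the spaces [K_n].  When all
coordinates of [x] except [x n] are fixed, [f] becomes a translate of [f_n],
so the preimage under [f] of a translate of [B n] has a meager trace on every
section of [K] parallel to [K_n].  This preimage has the Baire property because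
[B n] is Borel, so the Kuratowski-Ulam theorem makes it meager in [K]
([meager_of_meager_sections]); a countable union of meager sets is meager.

For the sum to converge, the [f_n] must be small.  Restricting a witness to the
closure of a small open set and translating it puts its range inside any
prescribed neighbourhood of [0] and preserves the meagerness of all preimages
([haar_meager_probe]).  A complete metric of [X] need not be translation
invariant, so the neighbourhoods are chosen recursively: the [n]-th one must
move every point of the compact set [f_0 (K_0) + ... + f_{n-1} (K_{n-1})] by
less than [2 ^- n] in the complete metric ([summable_probes]).  The partial sums
then converge uniformly, and the sum is continuous ([infinite_sum]).

The spaces in this construction, closed subspaces and a countable product, come
with pseudometrics that define Hausdorff topologies.  A genuine metric is
recovered only at the end, for the finished witness ([hausdorff_metrizable]). *)

Set Implicit Arguments.
Unset Strict Implicit.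
Unset Printing Implicit Defensive.

Import Order.TTheory GRing.Theory Num.Theory.

Local Open Scope classical_set_scope.
Local Open Scope ring_scope.

(** * Meager sets *)

Lemma nowhere_denseP (T : topologicalType) (A : set T) :
  nowhere_dense A <->
  forall U : set T, open U -> U !=set0 -> ~ U `<=` closure A.
Proof.
split=> [ndA U oU [x Ux] UA|ndA].
  have : interior (closure A) x.
    by rewrite /interior; apply: filterS UA _; apply: open_nbhs_nbhs.
  by rewrite ndA.
apply/eqP/negPn/negP => /set0P ne.
by apply: (ndA _ (open_interior _) ne); exact: interior_subset.
Qed.

Lemma sub_nowhere_dense (T : topologicalType) (A B : set T) :
  A `<=` B -> nowhere_dense B -> nowhere_dense A.
Proof.
move=> AB /nowhere_denseP ndB; apply/nowhere_denseP => U oU U0 UA.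
by apply: (ndB U) => //; apply: subset_trans UA _; exact: closureS.
Qed.

Lemma nowhere_dense0 (T : topologicalType) : nowhere_dense (@set0 T).
Proof. by rewrite /nowhere_dense closure0 interior0. Qed.

(** The definition of meagerness asks for a sequence whose union is exactly the
set; an injection of the index set into [nat] and intersections with [A] turn
any countable cover into such a sequence. *)
Lemma meager_countable_cover (T : topologicalType) (I : Type) (D : set I)
    (F : I -> set T) (A : set T) : countable D ->
  (forall i, D i -> nowhere_dense (F i)) -> A `<=` \bigcup_(i in D) F i ->
  meager A.
Proof.
move=> /countable_injP[f finj] ndF AF.
exists (fun n => A `&` \bigcup_(i in [set i | D i /\ f i = n]) F i); last first.
  rewrite -setI_bigcupr; apply/esym/setIidPl => x /AF[i Di Fix].
  by exists (f i) => //; exists i.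
move=> n; have [[i [Di fin]]|noi] := pselect (exists i, D i /\ f i = n).
  apply: sub_nowhere_dense (ndF i Di) => x [_ [k [Dk fkn] Fkx]].
  by have <- : k = i by apply: finj; rewrite ?inE // fkn.
apply: sub_nowhere_dense (@nowhere_dense0 T) => x [_ [k [Dk fkn] _]].
by apply: noi; exists k.
Qed.

Lemma sub_meager (T : topologicalType) (A B : set T) :
  A `<=` B -> meager B -> meager A.
Proof.
move=> AB [F ndF BE]; apply: (@meager_countable_cover _ _ setT F) => //.
by rewrite -BE.
Qed.

Lemma meager_bigcup (T : topologicalType) (A : nat -> set T) :
  (forall n, meager (A n)) -> meager (\bigcup_n A n).
Proof.
move=> mA; have {mA} /choice[F FP] : forall n, exists F : nat -> set T,
    (forall k, nowhere_dense (F k)) /\ A n = \bigcup_k F k.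
  by move=> n; have [F ndF AE] := mA n; exists F.
apply: (@meager_countable_cover _ _ setT (fun p => F p.1 p.2)) => //.
  by move=> [n k] _; exact: (FP n).1.
move=> x [n _]; rewrite (FP n).2 => -[k _ Fx].
by exists (n, k).
Qed.

Lemma meagerU (T : topologicalType) (A B : set T) :
  meager A -> meager B -> meager (A `|` B).
Proof.
move=> mA mB; rewrite -bigcup2E; apply: meager_bigcup => -[//|[//|n]].
by apply: (@meager_countable_cover _ nat set0 (fun=> set0)) => // x [].
Qed.

Lemma nowhere_dense_meager (T : topologicalType) (A : set T) :
  nowhere_dense A -> meager A.
Proof.
by move=> ndA; apply: (@meager_countable_cover _ _ [set: unit] (fun=> A))
  => // x Ax; exists tt.
Qed.

(** Openness of the map up to shrinking.  Unlike openness it holds for the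
inclusion of the closure of an open set, and it still suffices to pull meager
sets back. *)
Definition feebly_open (S T : topologicalType) (g : S -> T) : Prop :=
  forall U : set S, open U -> U !=set0 ->
    exists2 V : set T, open V /\ V !=set0 & V `<=` g @` U.

(** If an open set [U] lay in the closure of the preimage, hence in the preimage
of the closure, then an open subset of the image of [U] would lie in the closure
of [A]. *)
Lemma nowhere_dense_preimage (S T : topologicalType) (g : S -> T) (A : set T) :
  continuous g -> feebly_open g -> nowhere_dense A ->
  nowhere_dense (g @^-1` A).
Proof.
move=> cg og /nowhere_denseP ndA; apply/nowhere_denseP => U oU U0 UA.
have [V [oV V0] VU] := og U oU U0; apply: (ndA V) => // y /VU[x Ux <-].
have : (g @^-1` closure A) x.
  have cl : closed (g @^-1` closure A).
    by apply: preimage_closed; [move=> ? _; exact: cg|exact: closed_closure].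
  by apply: cl; apply: closureS (UA x Ux) => z Az; exact: subset_closure.
by [].
Qed.

Lemma meager_preimage (S T : topologicalType) (g : S -> T) (A : set T) :
  continuous g -> feebly_open g -> meager A -> meager (g @^-1` A).
Proof.
move=> cg og [F ndF ->]; exists (fun n => g @^-1` F n).
  by move=> n; exact: nowhere_dense_preimage.
by rewrite preimage_bigcup.
Qed.

(** * The Baire property *)

Definition baire_property (T : topologicalType) (E : set T) : Prop :=
  exists2 U : set T, open U & meager ((E `\` U) `|` (U `\` E)).

Lemma nowhere_dense_boundary (T : topologicalType) (C : set T) :
  closed C -> nowhere_dense (C `\` interior C).
Proof.
move=> cC; apply/nowhere_denseP => U oU [x Ux] UC.
have cl : closed (C `\` interior C).
  by rewrite setDE; apply: closedI => //; apply: open_closedC; exact: open_interior.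
have {}UC : U `<=` C `\` interior C.
  by move=> z /UC; rewrite -(closure_id _).1.
apply: (UC x Ux).2; rewrite /interior nbhsE; exists U => // z Uz.
exact: (UC z Uz).1.
Qed.

(** For complements: if [E] is [U] up to a meager set, then its complement is the
closed set [~` U] up to the same meager set, and a closed set differs from its
interior by its boundary, which is nowhere dense. *)
Lemma baire_property_sigma_algebra (T : topologicalType) :
  sigma_algebra setT (@baire_property T).
Proof.
split.
- exists set0; first exact: open0.
  rewrite setDv setUid; exact/nowhere_dense_meager/nowhere_dense0.
- move=> E [U oU mEU]; exists (interior (~` U)); first exact: open_interior.
  rewrite setTD; apply: sub_meager (meagerU mEU (nowhere_dense_meager
    (nowhere_dense_boundary (open_closedC oU)))).
  move=> x [[nEx nUx]|[/interior_subset nUx nEx]].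
    have [Ux|nUx'] := pselect (U x); first by left; right.
    by right.
  by left; left; split => //; exact: contrapT.
- move=> E bE; have {bE} /choice[U UP] : forall n, exists U : set T,
      open U /\ meager ((E n `\` U) `|` (U `\` E n)).
    by move=> n; have [U] := bE n; exists U.
  exists (\bigcup_n U n); first by apply: bigcup_open => n _; exact: (UP n).1.
  apply: sub_meager (meager_bigcup (fun n => (UP n).2)) => x.
  move=> [[[n _ Ex] nU]|[[n _ Ux] nE]]; exists n => //.
    by left; split => // Ux; apply: nU; exists n.
  by right; split => // Ex; apply: nE; exists n.
Qed.

Lemma borel_preimage_baire_property (S T : topologicalType) (g : S -> T)
    (B : set T) : continuous g -> borel B -> baire_property (g @^-1` B).
Proof.
move=> cg; have [P0 PC PU] := @baire_property_sigma_algebra S.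
apply: (@smallest_sub _ _ _ [set B | baire_property (g @^-1` B)]).
  split=> [|E PE|E PE] /=.
  - by rewrite preimage_set0.
  - by have := PC _ PE; rewrite setTD setTD preimage_setC.
  - by rewrite preimage_bigcup; exact: PU.
move=> U oU /=; exists (g @^-1` U); first by apply: open_comp => // x _; exact: cg.
by rewrite !setDv setUid; exact/nowhere_dense_meager/nowhere_dense0.
Qed.

(** * The Baire category theorem and the Kuratowski-Ulam theorem *)

Definition baire_space (T : topologicalType) : Prop :=
  forall U : set T, open U -> U !=set0 -> ~ meager U.

(** The Baire category theorem.  By regularity there are nonempty open sets
[O n], decreasing from [U], with the closure of [O n.+1] inside [O n] and
disjoint from the closure of [F n].  By compactness their closures have a common
point, which lies in [U] but in no [F n]. *)
Lemma compact_baire_space (T : uniformType) :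
  compact [set: T] -> baire_space T.
Proof.
move=> cT U oU U0 [F ndF UE].
pose ne (O : set T) := open O /\ O !=set0.
have shrink (nO : nat * set T) : exists O' : set T, ne nO.2 ->
    ne O' /\ closure O' `<=` nO.2 `\` closure (F nO.1).
  case: nO => n O /=; have [[oO O0]|nneO] := pselect (ne O); last first.
    by exists set0 => /nneO.
  have /nowhere_denseP/(_ O oO O0) := ndF n.
  move=> /existsNP[x /not_implyP[Ox nFx]].
  have oOF : open (O `\` closure (F n)).
    by rewrite setDE; apply: openI => //; apply: closed_openC; exact: closed_closure.
  have [V Vx VO] := @uniform_regular T x _ (open_nbhs_nbhs (conj oOF (conj Ox nFx))).
  exists (interior V) => _; split; last first.
    by apply: subset_trans VO; apply: closureS; exact: interior_subset.
  by split; [exact: open_interior|exists x].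
have [next nextP] := choice shrink.
pose O := fix O n := if n is m.+1 then next (m, O m) else U.
have neO n : ne (O n).
  by elim: n => [//|n IHn] /=; have [] := nextP (n, O n) IHn.
have cO n : closure (O n.+1) `<=` O n `\` closure (F n).
  by have [] := nextP (n, O n) (neO n).
have decO n m : (n <= m)%N -> O m `<=` O n.
  elim: m => [|m IHm]; first by rewrite leqn0 => /eqP ->.
  rewrite leq_eqVlt => /predU1P[-> //|]; rewrite ltnS => /IHm mn x Ox.
  by apply: mn; have /cO[] : closure (O m.+1) x by exact: subset_closure.
pose G : set_system T := filter_from setT O.
have FG : ProperFilter G.
  apply: filter_from_proper => [|i _]; last by have [] := neO i.
  apply: filter_from_filter; first by exists 0%N.
  move=> i j _ _; exists (maxn i j) => // x Ox.
  by split; apply: decO Ox; rewrite ?leq_maxl ?leq_maxr.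
have [x [_ Gx]] : [set: T] `&` cluster G !=set0 by apply: cT; exact: filterT.
have clOx n : closure (O n) x.
  by move: Gx; rewrite clusterE; apply; exists n.
have : U x by have /cO[] := clOx 1%N.
rewrite UE => -[n _ Fx].
by have /cO[_] := clOx n.+1; apply; exact: subset_closure.
Qed.

Section KuratowskiUlam.
Variables (P Y : topologicalType).
Hypothesis P_sc : @second_countable P.

(** If the section of [F] at [y] is dense in some open set, then the closed set
[D V] of the points [y] with [V `*` [set y] `<=` closure F] contains [y] for some
nonempty basic open [V].  Each of these countably many sets is nowhere dense: an
open [W `<=` D V] would give [V `*` W `<=` closure F]. *)
Lemma not_nowhere_dense_sections (F : set (P * Y)) :
  nowhere_dense F ->
  meager [set y | ~ nowhere_dense [set t | F (t, y)]].
Proof.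
move=> /nowhere_denseP ndF; have [B cB [oB basisB]] := P_sc.
pose D (V : set P) := [set y | forall t, V t -> closure F (t, y)].
apply: (@meager_countable_cover _ _ (B `&` [set V | V !=set0]) D).
- by apply: sub_countable cB; apply: subset_card_le => V [].
- move=> V [BV [t0 Vt0]].
  have clD : closed (D V).
    have -> : D V = \bigcap_(t in V) ((fun y : Y => (t, y)) @^-1` closure F).
      by [].
    apply: closed_bigI => t _; apply: preimage_closed; last exact: closed_closure.
    by move=> y _; apply: cvg_pair; [exact: cvg_cst|exact: cvg_id].
  apply/nowhere_denseP => W oW [y0 Wy0]; rewrite -(closure_id _).1// => WD.
  apply: (ndF (V `*` W)); first by rewrite openE => -[t y] [Vt Wy];
    exists (V, W) => //; split; apply: open_nbhs_nbhs; split => //; exact: oB.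
  - by exists (t0, y0).
  - by move=> [t y] [Vt Wy]; exact: WD.
- move=> y /= nnd; have : ~ (forall U, open U -> U !=set0 ->
      ~ U `<=` closure [set t | F (t, y)]) by move/nowhere_denseP.
  move=> /existsNP[U /not_implyP[oU /not_implyP[[t Ut] /contrapT Ucl]]].
  have [V [BV Vt] VU] := basisB t U (open_nbhs_nbhs (conj oU Ut)).
  exists V; first by split => //; exists t.
  move=> s /VU /Ucl clFs Q [[Q1 Q2] /= [Q1s Q2y] Q12].
  have [u [Fu Q1u]] := clFs _ Q1s.
  by exists (u, y); split => //; apply: Q12; split => //; exact: nbhs_singleton.
Qed.

Lemma not_meager_sections (N : set (P * Y)) :
  meager N -> meager [set y | ~ meager [set t | N (t, y)]].
Proof.
move=> [F ndF ->].
apply: sub_meager (meager_bigcup (fun n => not_nowhere_dense_sections (ndF n))).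
move=> y /= nm; apply: contrapT => nex; apply: nm.
exists (fun n => [set t | F n (t, y)]); last first.
  by apply/seteqP; split => t [n _ Ft]; exists n.
by move=> n; apply: contrapT => ndn; apply: nex; exists n.
Qed.

(** The converse half of the Kuratowski-Ulam theorem.  If [E] is not meager, it
agrees up to a meager set with a nonempty open [U], whose preimage contains a box
[V `*` W].  The Baire property of [Y] gives [y] in [W] at which the section of
the exceptional set is meager; then [V] is covered by that section and by the
section of [E], against the Baire property of [P].

The map [phi] takes the place of an identification of [Z] with a product, so that
[Y] can be [Z] itself, with [phi] overwriting one coordinate. *)
Lemma meager_of_meager_sections (Z : topologicalType) (phi : P * Y -> Z)
    (E : set Z) : baire_space P -> baire_space Y ->
  continuous phi -> feebly_open phi -> (forall z, exists p, phi p = z) ->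
  baire_property E -> (forall y, meager [set t | E (phi (t, y))]) -> meager E.
Proof.
move=> bP bY cphi ophi sphi [U oU mEU] mE.
have [U0|] := pselect (U !=set0); last first.
  move=> U0; apply: sub_meager mEU => z Ez; left; split => // Uz.
  by apply: U0; exists z.
exfalso; case: U0 => z Uz; have [[t0 y0] phiE] := sphi z.
have : nbhs (t0, y0) (phi @^-1` U).
  by apply: cphi; apply: open_nbhs_nbhs; rewrite phiE.
move=> [[V0 W0] /= [V0t W0y] VWU].
pose V := interior V0; pose W := interior W0.
have mN := not_meager_sections (meager_preimage cphi ophi mEU).
have [y [Wy my]] : exists y, W y /\
    meager [set t | (phi @^-1` ((E `\` U) `|` (U `\` E))) (t, y)].
  apply: contrapT => nex; apply: (bY W (open_interior _)); first by exists y0.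
  by apply: sub_meager mN => y Wy /= my; apply: nex; exists y.
apply: (bP V (open_interior _)); first by exists t0.
apply: sub_meager (meagerU (mE y) my) => t Vt.
have Ut : U (phi (t, y)).
  by apply: VWU; split; apply: interior_subset.
by have [Et|nEt] := pselect (E (phi (t, y))); [left|right; right].
Qed.

End KuratowskiUlam.

Lemma compact_pseudometric_second_countable (R : realType)
    (T : pseudoMetricType R) :
  [set: T] !=set0 -> compact [set: T] -> @second_countable T.
Proof.
move=> [x0 _] cT.
pose T' : pseudoPMetricType R := HB.pack T (isPointed.Build T x0).
exact: (@compact_second_countable R T' cT).
Qed.

(** * Subspaces, metrization, products and uniform limits *)

Lemma injective_continuous_hausdorff (S T : topologicalType) (g : S -> T) :
  injective g -> continuous g -> hausdorff_space T -> hausdorff_space S.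
Proof.
move=> gI cg hT p q pq; apply: gI; apply: hT => A B nA nB.
by have [x [Ax Bx]] := pq _ _ (cg _ _ nA) (cg _ _ nB); exists (g x).
Qed.

Lemma set_val_continuous (T : topologicalType) (A : set T) :
  continuous (set_val : A -> T).
Proof. exact: initial_continuous. Qed.

Lemma compact_set_type (T : topologicalType) (A : set T) :
  compact A -> compact [set: A].
Proof.
move=> cA F FF _.
have FA : (set_val @ F) A by rewrite /fmap /=; apply: filterE => x; exact: set_valP.
have [p [Ap clp]] := cA (set_val @ F) _ FA.
exists (SigSub (mem_set Ap)); split => // P Q FP [_ [[Q' oQ' <-] Q'p Q'Q]].
have FP' : (set_val @ F) (set_val @` P) by rewrite /fmap /=; apply: filterS FP => x Px; exists x.
have [_ [[x Px <-] Q'x]] := clp _ _ FP' (open_nbhs_nbhs (conj oQ' Q'p)).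
by exists x; split => //; exact: Q'Q.
Qed.

(** A nonempty relatively open subset of [closure O] meets [O] in a nonempty
open set. *)
Lemma feebly_open_set_val_closure (T : topologicalType) (O : set T) :
  open O -> feebly_open (set_val : closure O -> T).
Proof.
move=> oO U [V oV <-] [x Vx].
have [y [Oy Vy]] := set_valP x V (open_nbhs_nbhs (conj oV Vx)).
exists (O `&` V); first by split; [exact: openI|exists y].
move=> z [Oz Vz].
by exists (SigSub (mem_set (subset_closure Oz))).
Qed.

(** A copy of [T] that forgets its topology, so that another metric can be
installed on it. *)
Definition remetrized (T : Type) : Type := T.
HB.instance Definition _ (T : choiceType) := Choice.on (remetrized T).

Section BallMetric.
Variables (R : realType) (T : pseudoMetricType R).
Hypothesis hT : hausdorff_space T.

(* Radii of at least 1 are always admitted: this bounds the distance by 1 and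
   keeps the infimum meaningful when no ball around [x] contains [y]. *)
Let radii (x y : T) : set R := [set e | 0 < e /\ (ball x e y \/ 1 <= e)].
Let dist (x y : remetrized T) : R := inf (radii x y).

Let radii1 x y : radii x y 1.
Proof. by split => //; right. Qed.

Let radii_neq0 x y : radii x y !=set0.
Proof. by exists 1. Qed.

Let dist_le x y e : radii x y e -> dist x y <= e.
Proof. by move=> re; apply: ge_inf => //; exists 0 => r [/ltW]. Qed.

Let dist_lt x y e : dist x y < e -> exists2 r, radii x y r & r < e.
Proof. exact: inf_lt. Qed.

Let dist_ge0 x y : 0 <= dist x y.
Proof. by apply: lb_le_inf => // r [/ltW]. Qed.

Let distxx x : dist x x = 0.
Proof.
apply/eqP; rewrite eq_le dist_ge0 andbT; apply/ler_addgt0Pl => e e0.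
by rewrite addr0; apply: dist_le; split => //; left; exact: ballxx.
Qed.

Let dist_lt_ball x y e : 0 < e -> dist x y < Num.min e 1 -> ball x e y.
Proof.
move=> e0 /dist_lt[r [r0 rP]]; rewrite lt_min => /andP[re r1].
case: rP => [|/(lt_le_trans r1)]; last by rewrite ltxx.
by apply: le_ball; exact: ltW.
Qed.

Let dist_positivity x y : dist x y = 0 -> x = y.
Proof.
move=> d0; apply: hT => A B /nbhs_ballP[e /= e0 eA] /nbhs_singleton By.
exists y; split => //; apply: eA; apply: dist_lt_ball => //.
by rewrite d0 lt_min e0 ltr01.
Qed.

Let dist_sym x y : dist x y = dist y x.
Proof. by rewrite /dist; congr inf; apply/seteqP; split => e [e0 [/ball_sym|]];
  split => //; [left|right|left|right]. Qed.

Let dist_triangle y x z : dist x z <= dist x y + dist y z.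
Proof.
apply/ler_addgt0Pl => e e0.
have [r [r0 rP] rd] : exists2 r, radii x y r & r < dist x y + e / 2.
  by apply: dist_lt; rewrite ltrDl divr_gt0.
have [s [s0 sP] sd] : exists2 r, radii y z r & r < dist y z + e / 2.
  by apply: dist_lt; rewrite ltrDl divr_gt0.
have -> : e + (dist x y + dist y z) = (dist x y + e / 2) + (dist y z + e / 2).
  by rewrite addrACA -splitr addrC.
apply: (@le_trans _ _ (r + s)); last by rewrite lerD // ltW.
apply: dist_le; split; first exact: addr_gt0.
case: rP => [xy|r1]; last by right; rewrite (le_trans r1)// lerDl ltW.
case: sP => [yz|s1]; last by right; rewrite (le_trans s1)// lerDr ltW.
by left; exact: ball_triangle yz.
Qed.

(** The balls of a pseudometric need not be given by a distance.  The infimum of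
the radii [r] with [ball x r y], truncated at 1, is a distance that induces the
same topology; it separates points because the space is Hausdorff. *)
Lemma hausdorff_metrizable : exists M : metricType R, homeomorphic M T.
Proof.
pose M : metricType R := HB.pack (remetrized T)
  (isMetric.Build R (remetrized T) distxx dist_positivity dist_sym dist_triangle).
exists M; exists (id : M -> T), (id : T -> M); split => //.
- move=> x A /nbhs_ballP[e /= e0 eA]; apply/(@nbhs_ballP R M).
  exists (Num.min e 1) => /=; first by rewrite lt_min e0 ltr01.
  by move=> y; rewrite ballEmdist => dxy; apply: eA; exact: dist_lt_ball.
- move=> x A /nbhs_ballP[e /= e0 eA]; apply/(@nbhs_ballP R T).
  exists (e / 2) => /=; first by rewrite divr_gt0.
  move=> y xy; apply: eA; rewrite ballEmdist /=.
  apply: (@le_lt_trans _ _ (e / 2)).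
    by apply: dist_le; split; [rewrite divr_gt0|left].
  by rewrite ltr_pdivrMr // ltr_pMr // ltr1n.
Qed.

End BallMetric.

Lemma continuous_pair (S T U : topologicalType) (f : S -> T) (g : S -> U) :
  continuous f -> continuous g -> continuous (fun s => (f s, g s)).
Proof. by move=> cf cg s; apply: cvg_pair; [exact: cf|exact: cg]. Qed.

Lemma continuous_comp_total (S T U : topologicalType) (f : S -> T) (g : T -> U) :
  continuous f -> continuous g -> continuous (g \o f).
Proof. by move=> cf cg s; apply: continuous_comp; [exact: cf|exact: cg]. Qed.

Section Product.
Variables (I : eqType) (K : I -> topologicalType).
Local Notation prodK := (prod_topology K : topologicalType).

Lemma continuous_to_prod (S : topologicalType) (g : S -> prodK) :
  (forall i, continuous (fun s => g s i)) -> continuous g.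
Proof.
move=> cg s; apply/cvg_sup => i.
exact: (@continuous_comp_initial (forall i, K i) S (K i) (fun x => x i) g (cg i)).
Qed.

(** The map to which the Kuratowski-Ulam theorem is applied: its sections are
the sections of [prodK] parallel to the [n]-th factor. *)
Definition replace (n : I) (p : K n * prodK) : prodK := dfwith p.2 n p.1.

Lemma replace_continuous n : continuous (@replace n).
Proof.
apply: continuous_to_prod => i [t x].
have [->|ni] := eqVneq i n.
  rewrite (_ : (fun s => _) = fst) ?funeqE; first exact: cvg_fst.
  by move=> -[u y]; rewrite /replace /= dfwithin.
rewrite (_ : (fun s => _) = proj i \o snd) ?funeqE.
  apply: (@continuous_comp _ prodK (K i) snd (proj i)); first exact: cvg_snd.
  exact: (@proj_continuous I K i x).
by move=> -[u y]; rewrite /replace /= dfwithout // eq_sym.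
Qed.

Lemma replace_self n (z : prodK) (t : K n) : replace (z n, dfwith z n t) = z.
Proof.
apply: functional_extensionality_dep => i; rewrite /replace /=.
have [<-|ni] := eqVneq n i; first by rewrite dfwithin.
by rewrite !dfwithout.
Qed.

Lemma replace_surjective n (t : K n) (z : prodK) : exists p, @replace n p = z.
Proof. by exists (z n, dfwith z n t); exact: replace_self. Qed.

(** The continuous map [z |-> (z n, replace (x n, z))] is a right inverse of
[replace] that takes the value [(t, x)] at [replace (t, x)], so the preimage of [U] under it is an open
subset of the image of [U]. *)
Lemma feebly_open_replace n : feebly_open (@replace n).
Proof.
move=> U oU [[t x] Utx].
pose sec (z : prodK) : K n * prodK := (z n, @replace n (x n, z)).
have csec : continuous sec.
  apply: continuous_pair; first exact: proj_continuous.
  apply: (continuous_comp_total (f := fun z : prodK => (x n, z)));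
    last exact: replace_continuous.
  by apply: continuous_pair => z; [exact: cst_continuous|exact: cvg_id].
exists (sec @^-1` U); last first.
  by move=> z Uz; exists (sec z) => //; exact: replace_self.
split; first by apply: open_comp => // z _; exact: csec.
exists (replace (t, x)); rewrite /= /sec.
suff -> : (replace (t, x) n, replace (x n, replace (t, x))) = (t, x) by [].
congr pair; first by rewrite /replace /= dfwithin.
apply: functional_extensionality_dep => i; rewrite /replace /=.
have [<-|ni] := eqVneq n i; first by rewrite dfwithin.
by rewrite !dfwithout.
Qed.

End Product.

Section UniformLimit.
Variables (R : realType) (M : metricType R) (T : topologicalType).
Variable u : nat -> T -> M.
Hypothesis M_complete : complete_metric M.
Hypothesis u_continuous : forall n, continuous (u n).
Hypothesis u_geometric : forall n x, mdist (u n x) (u n.+1 x) <= 2 ^- n.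

(* The sum of [2 ^- k] over [k >= n]. *)
Let tail n : R := 2 * 2 ^- n.

Let tailS n : tail n = 2 ^- n + tail n.+1.
Proof.
by rewrite /tail exprSr invfM mulrCA mulfV // mulr1 mulr2n mulrDl mul1r.
Qed.

Let tail_ge0 n : 0 <= tail n.
Proof. by rewrite /tail mulr_ge0 // invr_ge0 exprn_ge0. Qed.

Let tail_small e : 0 < e -> exists n, tail n < e.
Proof.
move=> e0; exists (Num.truncn (2 / e)).+1.
rewrite /tail ltr_pdivrMr ?exprn_gt0 // mulrC -ltr_pdivrMr //.
apply: lt_trans (truncnS_gt _) _.
by rewrite -natrX ltr_nat ltn_expl.
Qed.

Let dist_tail n m x : (n <= m)%N -> mdist (u n x) (u m x) <= tail n.
Proof.
move=> /subnKC <-; move: (m - n)%N => k.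
(* strengthened for the induction: the next step fits in [tail (n + k)] *)
suff : mdist (u n x) (u (n + k) x) + tail (n + k) <= tail n.
  by apply: le_trans; rewrite lerDl.
elim: k => [|k IHk]; first by rewrite addn0 mdistxx add0r.
apply: le_trans IHk; rewrite (tailS (n + k)) addnS addrA lerD2r.
by apply: le_trans (metric_triangle _ (u (n + k) x) _) _; rewrite lerD2l.
Qed.

(** The distance from [u n] to its limit is at most [tail n] at every point, so
the convergence is uniform. *)
Lemma uniform_limit_continuous_exists :
  exists2 v : T -> M, continuous v & forall x, u ^~ x @ \oo --> v x.
Proof.
have /choice[v uv] : forall x, exists l : M, u ^~ x @ \oo --> l.
  move=> x; apply: M_complete; apply: cauchy_exP => e e0.
  have [n ne] := tail_small e0; exists (u n x); exists n => // m /= nm.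
  by rewrite ballEmdist /=; apply: le_lt_trans ne; exact: dist_tail.
have uv_tail n x : mdist (u n x) (v x) <= tail n.
  apply/ler_addgt0Pr => e e0.
  have /metricType_numDomainType.cvgrPdist_lt /(_ e e0)[m _ mP] := uv x.
  apply: le_trans (metric_triangle _ (u (maxn n m) x) _) _.
  apply: lerD; first by apply: dist_tail; rewrite leq_maxl.
  by rewrite metric_sym ltW //; apply: mP; rewrite /= leq_maxr.
exists v => // x; apply/metricType_numDomainType.cvgrPdist_lt => e e0.
have [n ne] : exists n, tail n < e / 3 by apply: tail_small; rewrite divr_gt0.
have : u n y @[y --> x] --> u n x by exact: u_continuous.
move=> /metricType_numDomainType.cvgrPdist_lt /(_ (e / 3)).
rewrite divr_gt0 // => /(_ isT); apply: filterS => y xy.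
have -> : e = e / 3 + (e / 3 + e / 3) by field.
apply: le_lt_trans (metric_triangle _ (u n x) _) _; apply: ltrD.
  by rewrite metric_sym; apply: le_lt_trans ne.
apply: le_lt_trans (metric_triangle _ (u n y) _) _; apply: ltrD => //.
by apply: le_lt_trans ne.
Qed.

End UniformLimit.

(** * Sums of probes in a topological group *)

Lemma homeomorphism_feebly_open (S T : topologicalType) (f : S -> T)
    (g : T -> S) : cancel f g -> cancel g f -> continuous g -> feebly_open f.
Proof.
move=> fK gK cg U oU [x Ux]; exists (g @^-1` U).
  split; first by apply: open_comp => // y _; exact: cg.
  by exists (f x); rewrite /= fK.
by move=> y Uy; exists (g y).
Qed.

Section TopologicalGroup.
Variable X : topologicalZmodType.

(** Taking the preimage of a translate is taking the preimage under a translated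
map: this keeps [B] itself, whose Borelness is known. *)
Lemma preimage_translate (K : Type) (f : K -> X) (B : set X) (x : X) :
  f @^-1` translate B x = (fun k => f k - x) @^-1` B.
Proof.
apply/seteqP; split=> k /=; first by move=> [b Bb <-]; rewrite addrK.
by move=> Bk; exists (f k - x) => //; rewrite subrK.
Qed.

Lemma continuous_add (K : topologicalType) (f g : K -> X) :
  continuous f -> continuous g -> continuous (fun k => f k + g k).
Proof.
move=> cf cg.
exact: (continuous_comp_total (continuous_pair cf cg) (@add_continuous X)).
Qed.

Lemma continuous_addr (K : topologicalType) (f : K -> X) (x : X) :
  continuous f -> continuous (fun k => f k + x).
Proof. by move=> cf; apply: continuous_add => // k; exact: cst_continuous. Qed.

Lemma compact_sum (K : topologicalType) (L : set X) (g : K -> X) :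
  compact L -> compact [set: K] -> continuous g ->
  compact [set p.1 + g p.2 | p in L `*` [set: K]].
Proof.
move=> cL cK cg; apply: continuous_compact; last exact: compact_setX.
apply: continuous_subspaceT; apply: continuous_add.
  by move=> p; exact: cvg_fst.
by apply: (continuous_comp_total (g := g)) => // p; exact: cvg_snd.
Qed.

(** The inequality holds for pairs [(z, u)] near [(x, 0)], for each [x] in [L];
compactness of [L] makes the neighbourhood of [0] uniform.  This replaces
translation invariance of the metric. *)
Lemma compact_small_translation (R : realType) (M : metricType R) (j : X -> M)
    (L : set X) (e : R) : continuous j -> compact L -> 0 < e ->
  nbhs (0 : X) [set u | forall z, L z -> mdist (j z) (j (z + u)) < e].
Proof.
move=> cj /compact_near_coveringP cL e0.
apply: (cL _ (nbhs (0 : X)) (fun u z => mdist (j z) (j (z + u)) < e)) => x Lx.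
have e20 : 0 < e / 2 by rewrite divr_gt0.
have c1 : j (z.1) @[z --> (x, 0 : X)] --> j x.
  apply: (@continuous_cvg _ _ _ _ _ (fun z : X * X => z.1) j x (cj x)).
  exact: cvg_fst.
have c2 : j (z.1 + z.2) @[z --> (x, 0 : X)] --> j x.
  apply: (@continuous_cvg _ _ _ _ _ (fun z : X * X => z.1 + z.2) j x (cj x)).
  by rewrite -[in X in _ --> X](addr0 x); exact: (@add_continuous X (x, 0)).
move/metricType_numDomainType.cvgrPdist_lt : c1 => /(_ _ e20) n1.
move/metricType_numDomainType.cvgrPdist_lt : c2 => /(_ _ e20) n2.
near=> z.
apply: le_lt_trans (metric_triangle _ (j x) _) _.
rewrite (splitr e); apply: ltrD.
  by rewrite metric_sym; near: z.
by near: z.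
Unshelve. all: by end_near. Qed.

End TopologicalGroup.

(** A space together with a map into [X], bundled so that a sequence of them can
be obtained by choice. *)
Record probe (R : realType) (X : Type) := Probe {
  probe_dom :> pseudoMetricType R;
  probe_fun : probe_dom -> X }.

(** The Haar meager condition on a witness of [B], for a space whose topology is
given by a pseudometric: closed subspaces and countable products then stay in
the class. *)
Definition detects (R : realType) (X : topologicalZmodType) (B : set X)
    (p : probe R X) : Prop :=
  [/\ [set: p] !=set0, compact [set: p], hausdorff_space p,
      continuous (@probe_fun _ _ p) &
      forall x, meager (@probe_fun _ _ p @^-1` translate B x)].

Section HaarMeager.
Variables (R : realType) (X : topologicalZmodType).

(** The map [f] is close to [f k0] on the closure of a small open set [O]
containing [k0]; subtracting [f k0] brings the range near [0].  Meager subsets of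
[K] have meager traces on [closure O], since the inclusion is feebly open. *)
Lemma haar_meager_probe (B : set X) (K : metricType R) (f : K -> X) :
  [set: K] !=set0 -> compact [set: K] -> continuous f ->
  (forall x, meager (f @^-1` translate B x)) ->
  forall U : set X, nbhs 0 U ->
  exists2 p : probe R X, detects B p & forall k, U (@probe_fun _ _ p k).
Proof.
move=> [k0 _] cK cf mf U U0.
have c0 : continuous (fun k => f k - f k0) by exact: continuous_addr.
have nV : nbhs k0 ((fun k => f k - f k0) @^-1` U).
  by apply: c0; rewrite subrr.
have [V Vk0 VU] := @uniform_regular K k0 _ nV.
pose O := interior V; pose C : set K := closure O.
have Ck0 : C k0 by exact: subset_closure.
pose g (k : C) := f (set_val k) - f k0.
have cg : continuous g.
  exact: (continuous_comp_total (@set_val_continuous _ C) c0).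
exists (@Probe R X (C : pseudoMetricType R) g); last first.
  by move=> k /=; apply: VU; apply: closureS (set_valP k); exact: interior_subset.
split => //.
- by exists (SigSub (mem_set Ck0)).
- apply: compact_set_type; apply: (subclosed_compact _ cK) => //.
  exact: closed_closure.
- apply: (@injective_continuous_hausdorff C K set_val).
  + exact: val_inj.
  + exact: set_val_continuous.
  + exact: metric_hausdorff.
- move=> x /=.
  have -> : g @^-1` translate B x = set_val @^-1` (f @^-1` translate B (x + f k0)).
    rewrite !preimage_translate; apply/seteqP; split=> k /=;
    by rewrite /g opprD addrA addrAC.
  apply: meager_preimage => //; first exact: set_val_continuous.
  exact/feebly_open_set_val_closure/open_interior.
Qed.

Section Summation.
Variables (M : metricType R) (j : X -> M) (i : M -> X).
Hypotheses (jK : cancel j i) (iK : cancel i j).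
Hypotheses (cj : continuous j) (ci : continuous i).
Hypothesis M_complete : complete_metric M.

Definition partial_sum (p : nat -> probe R X) (n : nat)
    (x : forall k, p k) : X := \sum_(k < n) probe_fun (x k).

(** The recursion carries the compact set [L n] of all values of the [n]-th
partial sum; the [n]-th probe is chosen in terms of [L n]. *)
Lemma summable_probes (B : nat -> set X) :
  (forall n U, nbhs (0 : X) U ->
    exists2 p : probe R X, detects (B n) p & forall k, U (@probe_fun _ _ p k)) ->
  exists2 p : nat -> probe R X, forall n, detects (B n) (p n) &
    forall n (x : forall k, p k),
      mdist (j (partial_sum n x)) (j (partial_sum n.+1 x)) <= 2 ^- n.
Proof.
move=> small.
have /choice[q qP] : forall nL : nat * set X, exists p : probe R X,
    compact nL.2 -> detects (B nL.1) p /\ forall z k, nL.2 z ->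
      mdist (j z) (j (z + @probe_fun _ _ p k)) < 2 ^- nL.1.
  (* a noncompact [L] never occurs in the recursion; any probe serves there *)
  move=> [n L] /=; have [cL|ncL] := pselect (compact L); last first.
    by have [p _ _] := small 0%N setT filterT; exists p.
  have e0 : 0 < 2 ^- n :> R by rewrite invr_gt0 exprn_gt0.
  have [p dp pU] := small n _ (compact_small_translation cj cL e0).
  by exists p => _; split => // z k Lz; exact: pU.
pose L := fix L n : set X := if n is m.+1 then
  [set r.1 + @probe_fun _ _ (q (m, L m)) r.2 | r in L m `*` setT] else [set 0].
have cL n : compact (L n).
  elim: n => [|n cLn] /=; first exact: compact_set1.
  have [[_ cK _ cf _] _] := qP (n, L n) cLn.
  exact: compact_sum.
exists (fun n => q (n, L n)); first by move=> n; have [] := qP (n, L n) (cL n).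
move=> n x; have Lx m : L m (partial_sum m x).
  elim: m => [|m IHm]; first by rewrite /partial_sum big_ord0.
  rewrite /partial_sum big_ord_recr /=.
  by exists (partial_sum m x, x m).
have [_ /(_ _ (x n) (Lx n)) /ltW] := qP (n, L n) (cL n).
by rewrite /partial_sum big_ord_recr.
Qed.

Variable p : nat -> probe R X.
Hypothesis p_continuous : forall n, continuous (@probe_fun _ _ (p n)).
Hypothesis p_summable : forall n (x : forall k, p k),
  mdist (j (partial_sum n x)) (j (partial_sum n.+1 x)) <= 2 ^- n.

Local Notation prodp := (prod_topology (fun n => p n : topologicalType)).

Lemma partial_sum_continuous n :
  continuous (fun x : prodp => partial_sum n x : X).
Proof.
elim: n => [|n IHn].
  have -> : (fun x : prodp => partial_sum 0 x : X) = (fun=> 0).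
    by apply/funext => x; rewrite /partial_sum big_ord0.
  by move=> x; exact: cst_continuous.
have -> : (fun x : prodp => partial_sum n.+1 x : X) =
    (fun x : prodp => partial_sum n x + probe_fun (x n)).
  by apply/funext => x; rewrite /partial_sum big_ord_recr.
apply: continuous_add; first exact: IHn.
have cproj : continuous (fun x : prodp => x n).
  exact: (@proj_continuous nat (fun n => p n : topologicalType) n).
exact: (continuous_comp_total cproj (@p_continuous n)).
Qed.

Lemma partial_sum_replace n m (t : p n) (x : prodp) : (n < m)%N ->
  partial_sum m (replace (t, x)) =
  partial_sum m x - probe_fun (x n) + probe_fun t.
Proof.
move=> nm; have sumE (y : forall k, p k) : partial_sum m y =
    probe_fun (y n) + \sum_(k < m | k != Ordinal nm) probe_fun (y k).
  by rewrite /partial_sum (bigD1 (Ordinal nm)).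
rewrite (sumE (replace (t, x))) (sumE x).
rewrite [probe_fun (x n) + _]addrC addrK addrC; congr (_ + _).
  apply: eq_bigr => k kn; rewrite /replace /= dfwithout //.
  by apply: contra kn => /eqP nk; apply/eqP/val_inj.
by rewrite /replace /= dfwithin.
Qed.

(** Partial sums converge uniformly in the complete metric of [M], hence
pointwise in [X].  Overwriting a coordinate changes all late partial sums by the
same amount, and so changes the limit by this amount. *)
Lemma infinite_sum : exists2 f : prodp -> X, continuous f &
  forall n (t : p n) (x : prodp),
    f (replace (t, x)) = f x - probe_fun (x n) + probe_fun t.
Proof.
have cu n : continuous (fun x : prodp => j (partial_sum n x)).
  exact: (continuous_comp_total (@partial_sum_continuous n) cj).
have [v cv vP] := uniform_limit_continuous_exists M_complete cu p_summable.
have cvgX x : partial_sum n x @[n --> \oo] --> i (v x).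
  rewrite (_ : (fun n => _) = (fun n => i (j (partial_sum n x)))); last first.
    by apply/funext => n; rewrite jK.
  apply: (@continuous_cvg _ _ _ _ _ (fun n => j (partial_sum n x)) i (v x)).
    exact: ci.
  exact: vP.
exists (i \o v); first exact: continuous_comp_total.
move=> n t x; have hX : hausdorff_space X.
  apply: (injective_continuous_hausdorff (can_inj jK) cj).
  exact: metric_hausdorff.
apply: (cvg_unique hX (cvgX (replace (t, x)))) => /=.
apply: cvg_trans (_ : (partial_sum m x - probe_fun (x n) + probe_fun t)
  @[m --> \oo] --> _).
  apply: near_eq_cvg; exists n.+1 => // m /= nm.
  by rewrite -partial_sum_replace.
pose shift (y : X) := y - probe_fun (x n) + probe_fun t.
have cshift : continuous shift.
  by do 2 apply: continuous_addr; move=> y; exact: cvg_id.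
apply: (@continuous_cvg _ _ _ _ _ (fun m => partial_sum m x) shift (i (v x))).
  exact: cshift.
exact: cvgX.
Qed.

End Summation.

(** A witness whose topology is Hausdorff and given by a pseudometric can be
replaced by a metric one: a homeomorphism preserves meagerness of preimages. *)
Lemma haar_meager_hausdorff_pseudometric (A B : set X) (K : pseudoMetricType R)
    (f : K -> X) : borel B -> A `<=` B -> [set: K] !=set0 ->
  compact [set: K] -> hausdorff_space K -> continuous f ->
  (forall x, meager (f @^-1` translate B x)) -> haar_meager R A.
Proof.
move=> bB AB [k0 _] cK hK cf mf.
have [N [g [h [gK hgK cg ch]]]] := hausdorff_metrizable hK.
exists B; split => //; exists N; split.
- by exists (h k0).
- have -> : [set: N] = h @` [set: K].
    by apply/seteqP; split => // y _; exists (g y).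
  by apply: continuous_compact => //; exact: continuous_subspaceT.
- exists (f \o g); first exact: continuous_comp_total.
  move=> x; rewrite comp_preimage; apply: meager_preimage => //.
  exact: homeomorphism_feebly_open gK hgK ch.
Qed.

Lemma haar_meager0 : haar_meager R (@set0 X).
Proof.
pose C : set R^o := [set 0].
apply: (@haar_meager_hausdorff_pseudometric _ set0 (C : pseudoMetricType R)
  (fun=> 0 : X)) => //.
- exact: sigma_algebra0.
- by exists (SigSub (mem_set (erefl : C 0))).
- exact/compact_set_type/compact_set1.
- apply: (@injective_continuous_hausdorff C R^o set_val).
  + exact: val_inj.
  + exact: set_val_continuous.
  + exact: metric_hausdorff.
- by move=> x; exact: cst_continuous.
- move=> x; apply: sub_meager (nowhere_dense_meager (@nowhere_dense0 _)).
  by move=> k [b []].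
Qed.

(** The infinite sum of small probes for the sets [B n] witnesses their union:
in direction [n] it is a translate of the [n]-th probe, so Kuratowski-Ulam
applies to each [B n] separately. *)
Lemma haar_meager_bigcup (A : nat -> set X) : completely_metrizable R X ->
  (forall n, haar_meager R (A n)) -> haar_meager R (\bigcup_n A n).
Proof.
move=> [M M_complete [i [j [iK jK ci cj]]]] hA.
have /choice[B BP] : forall n, exists B : set X, [/\ borel B, A n `<=` B &
    forall U, nbhs (0 : X) U ->
    exists2 p : probe R X, detects B p & forall k, U (@probe_fun _ _ p k)].
  move=> n; have [B [bB AB [K [K0 cK [f cf mf]]]]] := hA n.
  by exists B; split => //; exact: (haar_meager_probe K0 cK cf mf).
have Bsmall n : forall U, nbhs (0 : X) U ->
    exists2 p : probe R X, detects (B n) p & forall k, U (@probe_fun _ _ p k).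
  by have [] := BP n.
have [p dp sp] := summable_probes cj Bsmall.
have cp n : continuous (@probe_fun _ _ (p n)) by have [] := dp n.
have [f cf fE] := infinite_sum jK cj ci M_complete cp sp.
pose K : pseudoMetricType R := prod_topology (fun n => p n).
have cK : compact [set: K].
  rewrite (_ : [set: K] = [set x : K | forall n, [set: p n] (x n)]).
    apply: (@tychonoff nat (fun n => p n : topologicalType) (fun=> setT)) => n.
    by have [] := dp n.
  by apply/seteqP; split.
have x0 : [set: K] !=set0.
  have y n : p n by have [/cid[y _]] := dp n.
  by exists y.
have hK : hausdorff_space K.
  apply: (@hausdorff_product nat (fun n => p n : topologicalType)) => n.
  by have [] := dp n.
apply: (@haar_meager_hausdorff_pseudometric _ (\bigcup_n B n) K f) => //.
- by apply: sigma_algebra_bigcup => n; have [] := BP n.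
- by move=> a [n _ An]; exists n => //; have [_ AB _] := BP n; exact: AB.
move=> x; rewrite preimage_translate preimage_bigcup; apply: meager_bigcup => n.
have [n0 cpn _ _ mp] := dp n; have [t0 _] := n0.
apply: (@meager_of_meager_sections (p n) K _ K (@replace nat (fun n => p n) n)).
- exact: compact_pseudometric_second_countable.
- exact: compact_baire_space.
- exact: compact_baire_space.
- exact: replace_continuous.
- exact: feebly_open_replace.
- exact: replace_surjective.
- apply: borel_preimage_baire_property; last by have [] := BP n.
  exact: continuous_addr.
move=> y; have := mp (x - f y + probe_fun (y n)).
rewrite preimage_translate; congr meager; apply/funext => t /=.
rewrite fE; congr (B n _); rewrite opprD opprB addrC [in RHS]addrAC.
by congr (_ + _); rewrite addrAC.
Qed.

End HaarMeager.

Theorem theorem2p9 (R : realType) (X : topologicalZmodType)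
    (X_polish : polish R X) :
  sigma_ideal [set A : set X | haar_meager R A].
Proof.
have [_ X_metrizable] := X_polish; split.
- by exists set0; exact: haar_meager0.
- move=> A B AB [C [bC BC hC]]; exists C; split => //.
  exact: subset_trans BC.
- by move=> A hA; exact: haar_meager_bigcup.
Qed.
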